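(* Let $G$ be an Abelian group (written additively) and $\{a_n\}_{n\in\omega}$ a sequence of elements of $G$. Then $\{a_n\}_{n\in\omega}$ is a $PT$-sequence if and only if for each $k\in\omega$ and each $g\in G\setminus\{0\}$ there is $m\in\omega$ such that $g\notin A(k,m)$.
   Context: A paratopological group topology is a topology making addition jointly continuous; all such topologies are assumed $T_1$. A sequence $\{a_n\}_{n\in\omega}$ in $G$ is a $PT$-sequence if there is a ($T_1$) paratopological group topology on $G$ in which $\{a_n\}$ converges to $0$. For $m\in\omega$ put $A_m=\{a_i:i\ge m\}$ and $A_m^{*}=A_m\cup\{0\}$; for $k,m\in\omega$ put $A(k,m)=\{g_0+g_1+\cdots+g_k: g_0,\ldots,g_k\in A_m^{*}\}$. *)

(* Defs.v *)
From HB Require Import structures.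
From mathcomp Require Import all_boot all_order all_algebra.
From mathcomp Require Import all_classical topology.
From mathcomp Require Import pseudometric_normed_Zmodule.

Set Implicit Arguments.
Unset Strict Implicit.
Unset Printing Implicit Defensive.

Import GRing.Theory.
Local Open Scope classical_set_scope.
Local Open Scope ring_scope.

(* A topology on the carrier of G is a value tau : isOpenTopological G, that is,
   a family of open sets.  with_topology G tau keeps the group structure of G
   and adds that topology; no compatibility between the two is assumed. *)
Definition with_topology (G : zmodType) (tau : isOpenTopological G) :
  PreTopologicalZmodule.type := HB.pack (GRing.Zmodule.sort G) tau.

(* Only addition is required to be continuous, not the opposite, so
   topologicalZmodType would be too strong. *)
Definition paratopological_group_topology (G : zmodType)
    (tau : isOpenTopological G) : Prop :=
  let T := with_topology tau in
  accessible_space T /\ continuous (fun x : T * T => x.1 + x.2).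

Definition PT_sequence (G : zmodType) (a : nat -> G) : Prop :=
  exists tau : isOpenTopological G,
    paratopological_group_topology tau /\
    a n @[n --> \oo] --> (0 : with_topology tau).

Definition tail (G : zmodType) (a : nat -> G) (m : nat) : set G :=
  [set a i | i in [set i | (m <= i)%N]].

Definition tail0 (G : zmodType) (a : nat -> G) (m : nat) : set G :=
  tail a m `|` [set 0].

(* k.+1 summands, indexed from 0 to k *)
Definition tail_sums (G : zmodType) (a : nat -> G) (k m : nat) : set G :=
  [set \sum_(i < k.+1) g i | g in
    [set g : 'I_k.+1 -> G | forall i, tail0 a m (g i)]].

(* Main.v *)
(** For necessity, a neighborhood of [0] avoiding [g] contains [U + ... + U]
    for some smaller neighborhood [U], which contains a tail of [a].
    For sufficiency, take as neighborhoods of [0] the sets [U N] of all finite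
    sums [b_0 + ... + b_(k-1)] with [b_i] in [tail0 a (N i)], for
    [N : nat -> nat].  Every [g != 0] avoids some [U N]: if [g] is not in
    [S = tail0 a (N 0) + ... + tail0 a (N k.-1)], then [g] is not in
    [S + tail0 a m] for some [m], which is chosen as [N k].  Such an [m] exists
    because [S] is closed, a fact which the hypothesis on [tail_sums] yields by
    induction on [k]. *)
Require Import Defs.
From mathcomp Require Import all_boot all_order all_algebra.
From mathcomp Require Import all_classical topology.
From mathcomp Require Import pseudometric_normed_Zmodule.

Set Implicit Arguments.
Unset Strict Implicit.
Unset Printing Implicit Defensive.

Import GRing.Theory.
Local Open Scope classical_set_scope.
Local Open Scope ring_scope.

Section TailSums.
Variables (G : zmodType) (a : nat -> G).

Lemma tail0_0 m : tail0 a m 0.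
Proof. by right. Qed.

Lemma tail0_le m n : (m <= n)%N -> tail0 a n `<=` tail0 a m.
Proof.
move=> mn x [[i /= ni <-]|->]; last exact: tail0_0.
by left; exists i => //=; exact: leq_trans ni.
Qed.

(** Unlike in [tail_sums], each summand has its own tail, since the levels in a neighborhood of [0]
    vary with the position. *)
Fixpoint lsum (l : seq nat) : set G :=
  if l is n :: l' then [set b + s | b in tail0 a n & s in lsum l']
  else [set 0].

Lemma lsum_le l l' : all2 geq l l' -> lsum l `<=` lsum l'.
Proof.
elim: l l' => [|n l IH] [|n' l']//=; first by move=> _ x.
move=> /andP[n'n ll'] _ [b nb [s ls <-]].
by exists b; [exact: tail0_le nb|exists s => //; exact: IH ls].
Qed.

Lemma lsum_cons_sub n l : lsum l `<=` lsum (n :: l).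
Proof. by move=> s ls; exists 0; [exact: tail0_0|exists s; rewrite ?add0r]. Qed.

Lemma lsum_middle l1 n l2 : lsum (l1 ++ n :: l2) = lsum (n :: l1 ++ l2).
Proof.
elim: l1 => //= m l1 ->; apply/seteqP; split=> _ [b hb [_ [c hc [s hs <-]] <-]];
by exists c => //; exists (b + s); [exists b => //; exists s|rewrite addrCA].
Qed.

Lemma lsum_tail_sums k m : lsum (nseq k.+1 m) `<=` tail_sums a k m.
Proof.
move=> x hx.
suff [g hg ->] : exists2 g : nat -> G, (forall i, tail0 a m (g i)) &
    x = \sum_(i < k.+1) g i by exists (fun i => g i).
elim: {k}k.+1 x hx => [|k IH] x /=.
  by move=> ->; exists (fun=> 0); rewrite ?big_ord0// => _; exact: tail0_0.
move=> [b hb [s /IH[g hg ->] <-]].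
exists (fun i => if i is j.+1 then g j else b); first by case.
by rewrite big_ord_recl.
Qed.

Hypothesis tail_sums_sep :
  forall (k : nat) (g : G), g != 0 -> exists m : nat, ~ tail_sums a k m g.

(* Sequential compactness in disguise: in representations of [g] with [m]
   growing, the summand from [tail0 a n] either takes a fixed value for
   unboundedly many [m], and is split off, or escapes to infinity, and is
   absorbed into the [nseq] part. *)
Lemma lsum_closed l j g : (forall m, lsum (nseq j m ++ l) g) -> lsum l g.
Proof.
elim: l j g => [|n l IH] j g gl.
  apply: contrapT => /= /eqP g0; case: j gl => [/(_ 0%N) /= /eqP|j gl].
    exact/negP.
  by have [m] := tail_sums_sep j g0; apply; apply: lsum_tail_sums;
    rewrite -[nseq _ _]cats0.
have lsum_nseq_le p q : (p <= q)%N ->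
    lsum (nseq j q ++ l) `<=` lsum (nseq j p ++ l).
  move=> pq; apply: lsum_le; elim: {gl}j => [|j IHj] /=; last by rewrite pq.
  by elim: {IH}l => //= i l ->; rewrite leqnn.
have [[b nb bl]|nfix] :=
    pselect (exists2 b, tail0 a n b & forall m, lsum (nseq j m ++ l) (g - b)).
  by exists b => //; exists (g - b); [exact: IH bl|rewrite addrC subrK].
have {}nfix b : exists m, tail0 a n b -> ~ lsum (nseq j m ++ l) (g - b).
  apply: contrapT => hb; apply: nfix; exists b => [|m].
    by apply: contrapT => nb; apply: hb; exists 0%N.
  by apply: contrapT => nbm; apply: hb; exists m.
have [M MP] := choice nfix.
apply: lsum_cons_sub; apply: (IH j.+1) => p.
(* From level [M b] on, [b] cannot be the summand from [tail0 a n]. So a summand [b] occurring at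
   level [q] has [q < M b]; by the choice of [q] it is neither [0] nor an [a i] with [i < p]. *)
pose q := (M 0%R + p + \max_(i < p) M (a i))%N.
have := gl q; rewrite lsum_middle => -[b nb [s sl gE]].
have {}gE : s = g - b by rewrite -gE addrC addKr.
have Mq : (q < M b)%N.
  rewrite ltnNge; apply/negP => /lsum_nseq_le/(_ s sl).
  by rewrite gE; exact: MP.
exists b; last first.
  exists s; last by rewrite gE addrC subrK.
  by apply: lsum_nseq_le sl; rewrite /q addnAC leq_addl.
case: nb Mq => [[i ni <-]|-> ]; last by rewrite /q -addnA ltnNge leq_addr.
have [pi|ip] := leqP p i; first by move=> _; left; exists i.
rewrite ltnNge /q (leq_trans _ (leq_addl _ _))//.
exact: (leq_bigmax (F := fun i : 'I_p => M (a i)) (Ordinal ip)).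
Qed.

(* [:: N k.-1; ...; N 0], newest first *)
Definition prefix (N : nat -> nat) (k : nat) : seq nat :=
  iteri k (fun i l => N i :: l) [::].

Definition tail_nbhd (N : nat -> nat) : set G :=
  [set x | exists k, lsum (prefix N k) x].

Lemma tail_nbhd0 N : tail_nbhd N 0.
Proof. by exists 0%N. Qed.

Lemma tail_nbhd_le N N' : (forall i, N' i <= N i)%N ->
  tail_nbhd N `<=` tail_nbhd N'.
Proof.
move=> NN' x [k kx]; exists k; apply: lsum_le kx.
by elim: k => //= k ->; rewrite NN'.
Qed.

(** If [s] uses the first [k] levels of [N], the levels from [k] on remain free for [t]. This makes
    the translates of [tail_nbhd N] open. *)
Lemma tail_nbhd_shift N s : tail_nbhd N s ->
  exists N', forall t, tail_nbhd N' t -> tail_nbhd N (s + t).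
Proof.
move=> [k ks]; exists (fun i => N (i + k)%N) => t [j jt]; exists (j + k)%N.
elim: j t jt => [t ->|j IH _ [b hb [t ht <-]]]; first by rewrite addr0.
by exists b => //; exists (s + t); [exact: IH|rewrite addrCA].
Qed.

Lemma tail_nbhd_double N : exists N', forall s t,
  tail_nbhd N' s -> tail_nbhd N' t -> tail_nbhd N (s + t).
Proof.
(* The [i]-th summands of [s] and [t] will take positions [2i+1] and [2i] in [N]. *)
pose M i := maxn (N i.*2) (N i.*2.+1).
(* Padding with zeros brings [s] and [t] to the same length. *)
have lsumS k l : (k <= l)%N -> lsum (prefix M k) `<=` lsum (prefix M l).
  elim: l => [|l IH]; first by rewrite leqn0 => /eqP ->.
  rewrite leq_eqVlt => /predU1P[->//|/IH kl x /kl]; exact: lsum_cons_sub.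
exists M => s t [k ks] [l lt].
have {ks} := lsumS _ _ (leq_maxl k l) _ ks.
have {lt} := lsumS _ _ (leq_maxr k l) _ lt.
set j := maxn k l => tj sj; exists j.*2.
elim: j s t sj tj => [|j IH] s t; first by move=> -> ->; rewrite addr0.
move=> [b hb [s' hs' <-]] [c hc [t' ht' <-]].
exists b; first exact: tail0_le (leq_maxr _ _) _ hb.
exists (c + (s' + t')); last by rewrite addrACA -addrA.
exists c; first exact: tail0_le (leq_maxl _ _) _ hc.
by exists (s' + t') => //; exact: IH.
Qed.

Lemma tail_nbhd_tail0 N : tail0 a (N 0%N) `<=` tail_nbhd N.
Proof. by move=> x hx; exists 1%N, x => //; exists 0; rewrite ?addr0. Qed.

Lemma tail_nbhd_sep g : g != 0 -> exists N, ~ tail_nbhd N g.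
Proof.
move=> g0.
have /choice[f fP] l : exists n, ~ lsum l g -> ~ lsum (n :: l) g.
  apply: contrapT => hl; apply: (hl); exists 0%N => gl _; apply: gl.
  apply: (@lsum_closed _ 1) => m; apply: contrapT => mg.
  by apply: hl; exists m.
(* [L k] lists the first [k] levels, newest first, each chosen by [f] from the earlier ones. *)
pose L k := iter k (fun l => f l :: l) [::].
exists (f \o L) => -[k]; rewrite (_ : prefix _ k = L k); last first.
  by elim: k => //= k ->.
by elim: k => [/= /eqP|k IH]; [exact/negP|exact: fP].
Qed.

Definition tail_open : set_system G :=
  [set O | forall x, O x -> exists N, forall t, tail_nbhd N t -> O (x + t)].

Lemma tail_openT : tail_open setT.
Proof. by move=> x _; exists id. Qed.

Lemma tail_openI : setI_closed tail_open.
Proof.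
move=> A B Ao Bo x [/Ao[N NA] /Bo[M MB]].
exists (fun i => maxn (N i) (M i)) => t ht; split.
  by apply/NA/(tail_nbhd_le _ ht) => i; exact: leq_maxl.
by apply/MB/(tail_nbhd_le _ ht) => i; exact: leq_maxr.
Qed.

Lemma tail_open_bigU (I : Type) (f : I -> set G) :
  (forall i, tail_open (f i)) -> tail_open (\bigcup_i f i).
Proof.
move=> fo x [i _ /fo[N Nf]]; exists N => t /Nf ft; by exists i.
Qed.

Definition tail_topology : isOpenTopological G :=
  isOpenTopological.Build G tail_openT tail_openI tail_open_bigU.

Let T := with_topology tail_topology.

Lemma nbhs_tail_topology (x : T) (A : set T) :
  nbhs x A <-> exists N, forall t, tail_nbhd N t -> A (x + t).
Proof.
rewrite nbhsE; split=> [[B [Bo Bx] BA]|[N NA]].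
  by have [N NB] := Bo x Bx; exists N => t /NB/BA.
(* This is the translate [x + tail_nbhd N], open by [tail_nbhd_shift]. *)
exists [set y | tail_nbhd N (y - x)].
  split=> /=; last by rewrite subrr; exact: tail_nbhd0.
  move=> y /tail_nbhd_shift[N' N'N]; exists N' => t /N'N.
  by rewrite /= addrAC.
by move=> y /NA; rewrite addrC subrK.
Qed.

Lemma tail_topology_paratopological :
  paratopological_group_topology tail_topology.
Proof.
split=> [x y xy|[x y] A].
  (* Then [x + tail_nbhd N] is a neighborhood of [x] that misses [y]. *)
  have [|N Ny] := @tail_nbhd_sep (y - x); first by rewrite subr_eq0 eq_sym.
  have : nbhs (x : T) [set z | tail_nbhd N (z - x)].
    by apply/nbhs_tail_topology; exists N => t; rewrite /= addrC addKr.
  rewrite nbhsE => -[B [Bo Bx] BA].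
  exists B; split; [exact: Bo|exact/mem_set|].
  apply/mem_set => /BA /Ny; exact.
move=> /nbhs_tail_topology[N NA].
have [N' N'N] := tail_nbhd_double N.
exists ([set z | tail_nbhd N' (z - x)], [set z | tail_nbhd N' (z - y)]).
  by split; apply/nbhs_tail_topology; exists N' => t; rewrite /= addrC addKr.
move=> [u v] [/= ux vy]; have := NA _ (N'N _ _ ux vy).
by rewrite addrACA -!(addrC (- _)) !addNKr.
Qed.

Lemma tail_topology_cvg : a n @[n --> \oo] --> (0 : T).
Proof.
move=> A /nbhs_tail_topology[N NA]; exists (N 0%N) => // n /= Nn.
rewrite -[a n]add0r; apply/NA/tail_nbhd_tail0; by left; exists n.
Qed.

End TailSums.

(** By continuity at [(0, 0)], [W] contains some [A + B]; the last summand is kept in [B], and by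
    induction the others sum into [A]. *)
Lemma nbhs0_sum (G : zmodType) (tau : isOpenTopological G) (k : nat)
    (W : set (with_topology tau)) :
  continuous (fun x : with_topology tau * with_topology tau => x.1 + x.2) ->
  nbhs (0 : with_topology tau) W ->
  exists2 U, nbhs (0 : with_topology tau) U &
    forall g : 'I_k -> G, (forall i, U (g i)) -> W (\sum_i g i).
Proof.
move=> addc; elim: k W => [|k IH] W W0.
  by exists W => // g _; rewrite big_ord0; exact: (nbhs_singleton W0).
have [[A B] /= [A0 B0] ABW] : nbhs ((0, 0) : with_topology tau * with_topology tau)
    [set x | W (x.1 + x.2)] by apply: addc => /=; rewrite addr0.
have [U U0 UA] := IH _ A0.
exists (U `&` B); first exact: filterI.
move=> g gU; rewrite big_ord_recr; apply: (ABW (_, _)); split=> /=.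
  by apply: UA => i; have [] := gU (widen_ord (leqnSn k) i).
by have [] := gU ord_max.
Qed.

Theorem theorem5p9 (G : zmodType) (a : nat -> G) :
  PT_sequence a <->
  (forall (k : nat) (g : G), g != 0 -> exists m : nat, ~ tail_sums a k m g).
Proof.
split=> [[tau [[T1 addc] a0]] k g g0|sep]; last first.
  exists (tail_topology a); split; last exact: tail_topology_cvg.
  exact: tail_topology_paratopological.
have [|A [Ao /set_mem A0 /set_mem gA]] := T1 0 g; first by rewrite eq_sym.
(* Elements of [tail_sums a k m] have [k.+1] summands; once the tail from [m] lies in [U], these
   sums lie in [A], which misses [g]. *)
have [|U U0 UA] := @nbhs0_sum _ _ k.+1 A addc; first exact: open_nbhs_nbhs.
have [m _ mU] := a0 U U0.
exists m => -[h hm hg]; apply: gA; rewrite -hg; apply: UA => i.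
have [[j mj <-]|->] := hm i; [exact: mU|exact: (nbhs_singleton U0)].
Qed.
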